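(* Let $p$ be a prime, let $G$ be a finite $p$-group and let $c$ be a positive integer. Then there exists a subgroup $H$ of $G$ of nilpotency class at most $c$ such that $|H| \geq |G : \gamma_c(G)|$.
   Context: $\gamma_c(G)$ denotes the $c$th term of the lower central series of $G$, with $\gamma_1(G) = G$ and $\gamma_{c+1}(G) = [\gamma_c(G),G]$. *)

(* Defs.v *)
From mathcomp Require Export all_boot all_fingroup all_solvable.

(* Main.v *)
Require Import Defs.

Set Implicit Arguments.
Unset Strict Implicit.
Unset Printing Implicit Defensive.

Local Open Scope group_scope.

(** If the class of [G] is at most [c] there is nothing to do. Otherwise the
    idea is to replace [G] by a proper subgroup [I] for which the index of the
    [c]-th lower central term has not dropped, and to iterate.

    To find [I], choose [N] normal in [G] of index [p] in ['L_c.+1(G)] and let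
    [I] be the centralizer in [G] of ['L_c(G)] modulo [N]. It is proper, since
    [[~: 'L_c(G), G]] is not contained in [N]. Working modulo [N], so that
    [[~: 'L_c(G), G]] has order [p], the inequality [#|G : 'L_c(G)| <=
    #|I : 'L_c(I)|] amounts to [#|G : I| <= #|'L_c(G) : 'L_c(I)|] and results
    from two facts about [Z], the centralizer of [G] in ['L_c(G)]:
    - commutation is a pairing of [G / I] with ['L_c(G) / Z] whose values lie in
      a group of order [p] and whose left kernel is trivial, so that [G / I] is
      no larger than ['L_c(G) / Z] ([index_cent_small_comm]);
    - ['L_c(I)] is contained in [Z]: since [I] kills ['L_c(G)], moving the
      commutators from [I] over to [G] by the three subgroup lemma gives
      [[~: 'L_c(I), G] = 1] ([lcn_cent_lcn_central]). *)

Lemma three_subgroup_sub (gT : finGroupType) (N A B C : {group gT}) :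
    A \subset 'N(N) -> B \subset 'N(N) -> C \subset 'N(N) ->
    [~: A, B, C] \subset N -> [~: B, C, A] \subset N ->
  [~: C, A, B] \subset N.
Proof.
move=> nNA nNB nNC.
have trivE (X Y Z : {group gT}) :
    X \subset 'N(N) -> Y \subset 'N(N) -> Z \subset 'N(N) ->
  [~: X, Y, Z] \subset N = ([~: X / N, Y / N, Z / N] == 1).
  move=> nNX nNY nNZ.
  have nNXY : [~: X, Y] \subset 'N(N).
    by rewrite (subset_trans (commgSS nNX nNY)) ?der1_subG.
  rewrite -!quotientR // -subG1 quotient_sub1 //.
  by rewrite (subset_trans (commgSS nNXY nNZ)) ?der1_subG.
rewrite !trivE // => /eqP ABC /eqP BCA; apply/eqP.
exact: three_subgroup ABC BCA.
Qed.

Lemma lcn_comm_sub (gT : finGroupType) (G : {group gT}) i j :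
  [~: 'L_i.+1(G), 'L_j.+1(G)] \subset 'L_(i + j).+2(G).
Proof.
elim: j i => [|j IHj] i; first by rewrite addn0.
rewrite [[~: 'L_i.+1(G), _]]commGC (lcnSn j G).
have nL k m : 'L_k(G) \subset 'N('L_m(G)).
  by rewrite (subset_trans (lcn_sub _ _) (lcn_norm _ _)).
have nLG k : G \subset 'N('L_k(G)) := lcn_norm k G.
apply: (three_subgroup_sub (nLG _) (nL _ _) (nL _ _)).
  by rewrite [[~: G, _]]commGC -lcnSn addnS -addSn IHj.
by rewrite addnS /= (lcnSn (i + j).+1) commSg ?IHj.
Qed.

(** The three subgroup lemma moves one factor [I] of ['L_j.+1(I)] at a time to
    the other argument, where it is absorbed as a factor [G]. The other term of
    the lemma always lies in [[~: 'L_d.+1(G), I]], because the weights of the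
    two arguments add up to [d.+2]. *)
Lemma lcn_cent_lcn_comm1 (gT : finGroupType) (G I : {group gT}) d i j :
    I \subset G -> [~: 'L_d.+1(G), I] = 1 -> (i + j)%N = d ->
  [~: 'L_j.+1(I), 'L_i.+1(G)] = 1.
Proof.
move=> sIG cLI; elim: j i => [|j IHj] i dE.
  by rewrite lcn1 commGC -[i]addn0 dE.
rewrite (lcnSn j I) [[~: 'L_j.+1(I), I]]commGC.
apply: three_subgroup.
- apply/trivgP; rewrite -cLI commSg //= -dE addnS.
  rewrite [[~: 'L_j.+1(I), _]]commGC.
  exact: subset_trans (commgS _ (lcnS _ sIG)) (lcn_comm_sub _ _ _).
- apply/trivgP; rewrite -(IHj i.+1) ?addSnnS //.
  rewrite [[~: 'L_j.+1(I), 'L_i.+2(G)]]commGC.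
  by rewrite commSg // (lcnSn i G) commgS.
Qed.

Lemma lcn_cent_lcn_central (gT : finGroupType) (G : {group gT}) d :
  'L_d.+1('C_G('L_d.+1(G))) \subset 'C(G).
Proof.
apply/commG1P; apply: (@lcn_cent_lcn_comm1 _ G _ d 0 d) => //.
  exact: subsetIl.
by apply/commG1P; rewrite centsC subsetIr.
Qed.

(** Adjoining to a subgroup of [A] an element [k] that multiplies its order by
    [p] divides its centralizer in [G] by at most [p], since the conjugates of
    [k] lie in the coset of [T] at [k]. Climbing from the centralizer of [G] in
    [A] up to [A] by such steps gives the bound. *)
Lemma index_cent_small_comm (gT : finGroupType) (p : nat) (A G T : {group gT}) :
    p.-group A -> [~: A, G] \subset T -> #|T| <= p ->
  #|G : 'C_G(A)| <= #|A : 'C_A(G)|.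
Proof.
have [n] := ubnP #|A|; elim: n A => // n IHn A leAn pA sAGT leTp.
have [cGA | ncGA] := boolP (A \subset 'C(G)).
  by rewrite (setIidPl _) 1?centsC // indexgg indexg_gt0.
have [E | [M maxM sZM]] := maximal_exists (subsetIl A 'C(G)).
  by rewrite -E subsetIr in ncGA.
have nsMA := p_maximal_normal pA maxM.
have [sMA [k Ak notMk]] := properP (maxgroupp maxM).
have defA : M * <[k]> = A by rewrite (mulg_normal_maximal nsMA) ?cycle_subG.
have defZ : 'C_A(G) = 'C_M(G).
  apply/eqP; rewrite eqEsubset [X in _ && X]setSI // andbT.
  by rewrite subsetI sZM subsetIr.
have sCGA : 'C_G(A) \subset 'C_G(M) by rewrite setIS ?centS.
have leM : #|G : 'C_G(M)| <= #|M : 'C_M(G)|.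
  apply: IHn => //; last exact: subset_trans (commSg _ sMA) sAGT.
    by rewrite (leq_trans (proper_card (maxgroupp maxM))).
  exact: pgroupS pA.
have lek : #|'C_G(M) : 'C_G(A)| <= p.
  rewrite -defA centM cent_cycle setIA index_cent1 (leq_trans _ leTp) //.
  rewrite -(card_lcoset T k) subset_leq_card //.
  apply/subsetP=> _ /imsetP[g /setIP[Gg _] ->].
  by rewrite conjg_mulR mem_lcoset mulKg (subsetP sAGT) ?mem_commg.
rewrite -(Lagrange_index (subsetIl G 'C(M)) sCGA) defZ.
rewrite -(Lagrange_index sMA (subsetIl M 'C(G))) (p_maximal_index pA maxM).
by rewrite mulnC leq_mul.
Qed.

Lemma lcn_index_cent (gT : finGroupType) (p : nat) (G : {group gT}) d :
    p.-group G -> #|'L_d.+2(G)| <= p ->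
  #|G : 'C_G('L_d.+1(G))| <= #|'L_d.+1(G) : 'L_d.+1('C_G('L_d.+1(G)))|.
Proof.
move=> pG leLp; set I := 'C_G(_).
have pL : p.-group 'L_d.+1(G) := pgroupS (lcn_sub _ _) pG.
have le_cent := index_cent_small_comm (T := 'L_d.+2(G)%G) pL (subxx _) leLp.
apply: leq_trans le_cent _.
rewrite dvdn_leq ?indexg_gt0 // indexgS // subsetI.
by rewrite (lcnS _ (subsetIl _ _)) lcn_cent_lcn_central.
Qed.

(** A subgroup [I] / [N] of [G / N] has the same index as [I], whereas the index
    of ['L_d.+1(I)] in ['L_d.+1(G)] can only decrease modulo [N]; so the
    bound that holds in [G / N] for the centralizer of ['L_d.+1(G / N)] lifts to
    [G]. *)
Lemma lcn_index_descent (gT : finGroupType) (p : nat) (G : {group gT}) d :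
    prime p -> p.-group G -> 'L_d.+2(G) != 1 ->
  exists I : {group gT},
    I \proper G /\ #|G : 'L_d.+1(G)| <= #|I : 'L_d.+1(I)|.
Proof.
move=> p_pr pG ntL; pose L := 'L_d.+2(G)%G.
have pL : p.-group L := pgroupS (lcn_sub _ _) pG.
have [_ _ [m oL]] := pgroup_pdiv pL ntL.
have [|N [sNL nsNG oN]] := normal_pgroup (r := m) pG (lcn_normal d.+2 G).
  by rewrite oL pfactorK.
have nNG := normal_norm nsNG.
have defL n : 'L_n(G / N) = 'L_n(G) / N by rewrite -morphim_lcn.
have oLN : #|'L_d.+2(G / N)| = p.
  rewrite defL card_quotient ?(subset_trans (lcn_sub _ _)) //.
  by rewrite -divgS // oL oN expnS mulnK ?expn_gt0 ?prime_gt0.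
have [I defI sNI sIG] :=
  inv_quotientS nsNG (subsetIl (G / N) 'C('L_d.+1(G / N))).
have nNI := subset_trans sIG nNG.
exists I; split.
  rewrite properEneq sIG andbT; apply/eqP=> eqIG.
  have : #|'L_d.+2(G / N)| = 1%N.
    apply/eqP; rewrite -trivg_card1; apply/eqP; rewrite /= lcnSn.
    by apply/commG1P; rewrite centsC -{1}eqIG -defI subsetIr.
  by rewrite oLN => p1; rewrite p1 in p_pr.
have sLI : 'L_d.+1(I) \subset 'L_d.+1(G) := lcnS _ sIG.
have leGI : #|G : I| <= #|'L_d.+1(G) : 'L_d.+1(I)|.
  have := lcn_index_cent (quotient_pgroup N pG) (eq_leq oLN).
  rewrite /= defI -!morphim_lcn // index_quotient_eq ?subIset ?sNI ?orbT //.
  move/leq_trans; apply.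
  rewrite dvdn_leq ?indexg_gt0 // index_morphim //.
  by rewrite subIset // (subset_trans (lcn_sub _ _) nNG).
rewrite -(leq_pmul2r (indexg_gt0 'L_d.+1(G) 'L_d.+1(I))).
rewrite (Lagrange_index (lcn_sub d.+1 G) sLI).
by rewrite -(Lagrange_index sIG (lcn_sub d.+1 I)) mulnC leq_mul2l leGI orbT.
Qed.

Theorem proposition3p7 (p : nat) (gT : finGroupType) (G : {group gT}) (c : nat)
    (p_prime : prime p) (pG : p.-group G) (c_gt0 : (0 < c)%N) :
  exists H : {group gT},
    [/\ H \subset G, nilpotent H, (nil_class H <= c)%N
      & (#|G : 'L_c(G)| <= #|H|)%N].
Proof.
case: c c_gt0 => // d _.
have [n] := ubnP #|G|; elim: n G pG => // n IHn G pG leGn.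
have [L1 | ntL] := eqVneq 'L_d.+2(G) 1.
  have nilG := pgroup_nil pG.
  exists G; split=> //; first exact/lcn_nil_classP.
  by rewrite dvdn_leq ?cardG_gt0 ?dvdn_indexg.
have [I [ltIG leGI]] := lcn_index_descent p_prime pG ntL.
have [||H [sHI nilH clH leH]] := IHn I.
- exact: pgroupS (proper_sub ltIG) pG.
- exact: leq_trans (proper_card ltIG) _.
exists H; split=> //; first exact: subset_trans sHI (proper_sub ltIG).
exact: leq_trans leGI leH.
Qed.
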